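(* Let $n$ be a nonnegative integer and let $p(q)=a_0+qa_1+q^2a_2+\dots+q^na_n\not\equiv 0$ be a polynomial of degree $n$ (so $a_n\neq 0$) in an octonionic variable $q\in\mathbb{O}$, with octonionic coefficients $a_0,\dots,a_n\in\mathbb{O}$ satisfying $$|a_0|a^n\leq|a_1|a^{n-1}\leq\dots\leq|a_{n-2}|a^2\leq|a_{n-1}|a\leq|a_n|$$ for some real $a>0$. Then all the zeros of $p$ in $\mathbb{O}$ lie in $$|q|\leq\frac{1}{a}K_1,$$ where $K_1$ is the greatest positive root of the trinomial equation $$K^{n+1}-2K^n+1=0.$$
   Context: $\mathbb{O}$ denotes the (nonassociative, alternative) real division algebra of octonions, with real basis $e_0=1,e_1,\dots,e_7$ and multiplication $e_\alpha e_\beta=-\delta_{\alpha\beta}+\sum_{\gamma=1}^7\psi_{\alpha\beta\gamma}e_\gamma$ for $\alpha,\beta\in\{1,\dots,7\}$, where $\psi$ is totally antisymmetric, equals $1$ on the triples $(1,2,3),(1,4,5),(2,4,6),(3,4,7),(2,5,7),(1,7,6),(5,3,6)$, and vanishes on triples not obtained by permuting one of these. Every octonion is $\omega=\sum_{k=0}^7x_ke_k$ with $x_k\in\mathbb{R}$, and $|\omega|=\left(\sum_{k=0}^7x_k^2\right)^{1/2}$. Powers $q^k$ are unambiguous since $\mathbb{O}$ is power-associative, and $q^ka_k$ means the product of the octonion $q^k$ with the octonion $a_k$ on its right. A zero of $p$ is a $q\in\mathbb{O}$ with $p(q)=0$. *)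

(* Defs.v *)
From mathcomp Require Import all_boot all_order all_algebra.
From mathcomp Require Import reals.
Set Implicit Arguments.
Unset Strict Implicit.
Unset Printing Implicit Defensive.
Import Order.TTheory GRing.Theory Num.Theory.
Local Open Scope ring_scope.

(* The octonion sum_k x_k e_k is the row vector of its coordinates, so that   *)
(* addition and scaling by reals are those of row vectors.                    *)
Notation octonion R := 'rV[R]_8.

Definition octe {R : realType} (k : 'I_8) : octonion R := delta_mx 0 k.

Definition psi_triples : seq (nat * nat * nat) :=
  [:: (1, 2, 3); (1, 4, 5); (2, 4, 6); (3, 4, 7);
      (2, 5, 7); (1, 7, 6); (5, 3, 6)]%N.

(* Total antisymmetry: value 1 on the even (cyclic) rearrangements of the     *)
(* listed triples, -1 on the odd ones.                                        *)
Definition psi (a b c : nat) : int :=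
  if [|| (a, b, c) \in psi_triples, (b, c, a) \in psi_triples
       | (c, a, b) \in psi_triples] then 1
  else if [|| (b, a, c) \in psi_triples, (a, c, b) \in psi_triples
            | (c, b, a) \in psi_triples] then -1
  else 0.

Definition octe_mul {R : realType} (i j : 'I_8) : octonion R :=
  if i == 0 then octe j
  else if j == 0 then octe i
  else - (i == j)%:R *: octe 0
       + \sum_(k < 8 | k != 0) (psi i j k)%:~R *: octe k.

Definition octmul {R : realType} (x y : octonion R) : octonion R :=
  \sum_(i < 8) \sum_(j < 8) (x 0 i * y 0 j) *: octe_mul i j.

Definition octnorm {R : realType} (x : octonion R) : R :=
  Num.sqrt (\sum_(k < 8) x 0 k ^+ 2).

(* Right-nested powers; the bracketing is immaterial by power-associativity.  *)
Definition octexp {R : realType} (q : octonion R) (k : nat) : octonion R :=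
  iter k (octmul q) (octe 0).

Definition octpoly {R : realType} {n : nat} (a : 'I_n.+1 -> octonion R)
    (q : octonion R) : octonion R :=
  \sum_(k < n.+1) octmul (octexp q k) (a k).

Definition trinomial_root {R : realType} (n : nat) (K : R) : Prop :=
  K ^+ n.+1 - 2 * K ^+ n + 1 = 0.

Definition greatest_positive (R : realType) (P : R -> Prop) (K : R) : Prop :=
  [/\ 0 < K, P K & forall x : R, 0 < x -> P x -> x <= K].

(* Main.v *)
(* The octonion norm is multiplicative, so with x = r |q| the equation         *)
(* p(q) = 0 and the coefficient bounds |a_k| r^(n-k) <= |a_n| give             *)
(* x^n <= 1 + x + ... + x^(n-1).  If x > 1, multiplying by x - 1 yields        *)
(* f(x) <= 0 for f(K) = K^(n+1) - 2 K^n + 1; as f > 0 on [2, +oo[, f has a     *)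
(* root in [x, 2], whence x <= K1.  If x <= 1, then x <= K1 because f(1) = 0.  *)

Require Import Defs.
From mathcomp Require Import all_boot all_order all_algebra.
From mathcomp Require Import reals ring lra.
Set Implicit Arguments.
Unset Strict Implicit.
Unset Printing Implicit Defensive.
Import Order.TTheory GRing.Theory Num.Theory.
Local Open Scope ring_scope.

(** The octonions enter only through their norm, which is multiplicative ([octnormM]) and
    subadditive ([octnormD]). Multiplicativity is a polynomial identity in 16 real coordinates,
    [eight_square_identity]. Isolating the leading term of a zero and taking norms leaves a real
    inequality for [x = r |q|], namely [x ^+ n] is at most the sum of the lower powers of [x].
    [greatest_trinomial_root_ge] turns it into a bound by the largest root. *)

Definition octe_coef (i j k : nat) : int :=
  if i == 0%N then Posz (k == j) else if j == 0%N then Posz (k == i)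
  else if k == 0%N then - Posz (i == j) else psi i j k.

Lemma octe_mulE (R : realType) (i j k : 'I_8) :
  @octe_mul R i j 0 k = (octe_coef i j k)%:~R.
Proof.
rewrite /octe_mul /octe_coef.
case: ifP => i0; first by rewrite -[i == 0%N :> nat]/(i == 0) i0 !mxE.
rewrite -[i == 0%N :> nat]/(i == 0) i0.
case: ifP => j0; first by rewrite -[j == 0%N :> nat]/(j == 0) j0 !mxE.
rewrite -[j == 0%N :> nat]/(j == 0) j0 -[k == 0%N :> nat]/(k == 0).
rewrite !mxE summxE /=.
case: ifP => k0.
  rewrite big1 ?addr0 ?mulr1 ?mulrNz // => l l0.
  by rewrite !mxE (eqP k0) [0 == l]eq_sym (negbTE l0) /= mulr0.
rewrite mulr0 add0r (bigD1 k) ?k0 //= big1 => [|l /andP[_ lk]].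
  by rewrite !mxE !eqxx mulr1 addr0.
by rewrite !mxE [k == l]eq_sym (negbTE lk) /= mulr0.
Qed.

Lemma octmulE (R : realType) (x y : octonion R) (k : 'I_8) :
  octmul x y 0 k = \sum_(0 <= i < 8) \sum_(0 <= j < 8)
    x 0 (inord i) * y 0 (inord j) * (octe_coef i j k)%:~R.
Proof.
rewrite big_mkord /octmul summxE; apply: eq_bigr => i _.
rewrite big_mkord summxE; apply: eq_bigr => j _.
by rewrite !mxE !inord_val octe_mulE.
Qed.

(** Degen's eight-square identity. Indexing by [nat] makes every structure constant a closed
    integer, so the claim becomes an explicit polynomial identity. *)
Lemma eight_square_identity (R : comRingType) (x y : nat -> R) :
  \sum_(0 <= k < 8)
    (\sum_(0 <= i < 8) \sum_(0 <= j < 8) x i * y j * (octe_coef i j k)%:~R) ^+ 2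
  = (\sum_(0 <= k < 8) x k ^+ 2) * (\sum_(0 <= k < 8) y k ^+ 2).
Proof.
rewrite /index_iota /= !(big_cons, big_nil).
(* Each structure constant is replaced by its computed value: 0, 1 or -1. *)
do ?match goal with |- context [octe_coef ?i ?j ?k] =>
  let v := eval vm_compute in (octe_coef i j k) in
  change (octe_coef i j k) with v end.
rewrite -[Negz 0]/(- (1 : int)) !mulrNz !mulr1z !mulr0z.
rewrite !(mulr0, mulr1, mulrN1, add0r, addr0, oppr0).
ring.
Qed.

Section OctonionNorm.
Variable R : realType.
Implicit Types x y q : octonion R.

Lemma octnorm_ge0 x : 0 <= octnorm x.
Proof. exact: sqrtr_ge0. Qed.

Lemma sqr_octnorm x : octnorm x ^+ 2 = \sum_(k < 8) x 0 k ^+ 2.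
Proof. by rewrite sqr_sqrtr // sumr_ge0 // => k _; exact: sqr_ge0. Qed.

Lemma octnorm0 : octnorm (0 : octonion R) = 0.
Proof. by rewrite /octnorm big1 ?sqrtr0 // => k _; rewrite mxE expr0n. Qed.

Lemma octnorm_gt0 x : x != 0 -> 0 < octnorm x.
Proof.
apply: contraNT; rewrite -leNgt => x_le0; apply/eqP/rowP => k; rewrite mxE.
have /eqP nx0 : octnorm x == 0 by rewrite eq_le x_le0 octnorm_ge0.
have /esym/eqP := sqr_octnorm x.
rewrite nx0 expr0n psumr_eq0 => [/allP/(_ k)|i _]; last exact: sqr_ge0.
by rewrite mem_index_enum sqrf_eq0 => /(_ isT)/eqP.
Qed.

Lemma octnormN x : octnorm (- x) = octnorm x.
Proof.
by congr Num.sqrt; apply: eq_bigr => k _; rewrite mxE sqrrN.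
Qed.

Lemma octnorm_octe0 : octnorm (octe 0 : octonion R) = 1.
Proof.
rewrite /octnorm (bigD1 0) //= big1 => [|k k0]; rewrite !mxE //=.
  by rewrite addr0 expr1n sqrtr1.
by rewrite (negbTE k0) expr0n.
Qed.

Lemma octnormM x y : octnorm (octmul x y) = octnorm x * octnorm y.
Proof.
have normE (z : octonion R) :
    \sum_(k < 8) z 0 k ^+ 2 = \sum_(0 <= k < 8) z 0 (inord k) ^+ 2.
  by rewrite big_mkord; apply: eq_bigr => k _; rewrite inord_val.
rewrite /octnorm -sqrtrM; last by apply: sumr_ge0 => k _; exact: sqr_ge0.
congr Num.sqrt.
rewrite !normE -(eight_square_identity (fun k => x 0 (inord k))).
rewrite !big_mkord; apply: eq_bigr => k _.
by rewrite inord_val octmulE.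
Qed.

Lemma octnorm_exp q k : octnorm (octexp q k) = octnorm q ^+ k.
Proof.
elim: k => [|k IHk]; first by rewrite octnorm_octe0 expr0.
by rewrite /octexp iterS octnormM IHk exprS.
Qed.

(** After squaring, this is Cauchy-Schwarz. Zero vectors are set aside so that one may multiply by
    [s * t > 0] and argue coordinate by coordinate. *)
Lemma octnormD x y : octnorm (x + y) <= octnorm x + octnorm y.
Proof.
have [->|x0] := eqVneq x 0; first by rewrite octnorm0 !add0r.
have [->|y0] := eqVneq y 0; first by rewrite octnorm0 !addr0.
have [s_gt0 t_gt0] := (octnorm_gt0 x0, octnorm_gt0 y0).
set s := octnorm x in s_gt0 *; set t := octnorm y in t_gt0 *.
rewrite -(@ler_pXn2r _ 2) ?nnegrE ?octnorm_ge0 //; last by rewrite addr_ge0 ?ltW.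
rewrite sqr_octnorm sqrrD.
under eq_bigr do rewrite mxE sqrrD.
rewrite !big_split /= -!sqr_octnorm -/s -/t lerD2r lerD2l.
have st_gt0 : 0 < s * t by rewrite mulr_gt0.
rewrite -big_split -(ler_pM2l st_gt0) mulr_sumr.
(* AM-GM: [2 s t x_k y_k <= t^2 x_k^2 + s^2 y_k^2], summed over k *)
have -> : s * t * (s * t *+ 2) =
    \sum_(k < 8) (t ^+ 2 * x 0 k ^+ 2 + s ^+ 2 * y 0 k ^+ 2).
  by rewrite big_split /= -!mulr_sumr -!sqr_octnorm -/s -/t; ring.
apply: ler_sum => k _; rewrite -subr_ge0.
have -> : t ^+ 2 * x 0 k ^+ 2 + s ^+ 2 * y 0 k ^+ 2 - s * t * (x 0 k * y 0 k + x 0 k * y 0 k)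
   = (t * x 0 k - s * y 0 k) ^+ 2 by ring.
exact: sqr_ge0.
Qed.

Lemma octnorm_sum (I : finType) (F : I -> octonion R) :
  octnorm (\sum_i F i) <= \sum_i octnorm (F i).
Proof.
elim/big_ind2: _ => [|x a y b xa yb|//]; first by rewrite octnorm0.
exact: le_trans (octnormD _ _) (lerD xa yb).
Qed.

End OctonionNorm.

Lemma greatest_trinomial_root_ge (R : realType) (n : nat) (K x : R) :
  greatest_positive (@trinomial_root R n) K ->
  x ^+ n <= \sum_(k < n) x ^+ k -> x <= K.
Proof.
move=> [_ _ Kmax] xn_le; have K_ge1 : 1 <= K.
  by apply: Kmax => //; rewrite /trinomial_root !expr1n; ring.
have [x_le1|x_gt1] := leP x 1; first exact: le_trans K_ge1.
pose f : {poly R} := 'X^(n.+1) - 2 *: 'X^n + 1.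
have fE z : f.[z] = z ^+ n.+1 - 2 * z ^+ n + 1 by rewrite /f !hornerE.
have fx_le0 : f.[x] <= 0.
  (* The geometric sum converts the hypothesis on [x] into [f(x) <= 0]; the direction is kept since
     [x - 1 > 0]. *)
  have geo : (x - 1) * \sum_(k < n) x ^+ k = x ^+ n - 1.
    by rewrite -subrX1.
  have : (x - 1) * x ^+ n <= x ^+ n - 1.
    by rewrite -geo ler_wpM2l // subr_ge0 ltW.
  by rewrite fE exprS; lra.
(* Since [f(x) = x^n (x - 2) + 1], [f] is positive beyond 2, and [f(2) = 1] closes the interval for
   the intermediate value theorem. *)
have x_le2 : x <= 2.
  rewrite leNgt; apply/negP => x_gt2.
  have xn_ge0 : 0 <= x ^+ n by rewrite exprn_ge0 // (le_trans _ (ltW x_gt1)).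
  by move: fx_le0; rewrite fE exprS; nra.
have f2 : f.[2] = 1 by rewrite fE exprS; ring.
have [|y /andP[xy _] /rootP] := @poly_ivt _ f x 2 x_le2.
  by rewrite fx_le0 f2 ler01.
rewrite fE => fy0; apply: (le_trans xy (Kmax _ _ fy0)).
by rewrite (lt_le_trans _ xy) // (lt_trans _ x_gt1).
Qed.

Theorem theorem3p3 (R : realType) (n : nat) (a : 'I_n.+1 -> octonion R)
    (lead_neq0 : a ord_max != 0) (r : R) (r_gt0 : 0 < r)
    (coef_le : forall i j : 'I_n.+1, j = i.+1 :> nat ->
       octnorm (a i) * r ^+ (n - i) <= octnorm (a j) * r ^+ (n - j))
    (K1 : R) (K1_greatest : greatest_positive (@trinomial_root R n) K1)
    (q : octonion R) (q_zero : octpoly a q = 0) :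
  octnorm q <= r^-1 * K1.
Proof.
have lead_gt0 := octnorm_gt0 lead_neq0.
(* The chain of coefficient bounds is composed by induction on the distance [m] to the top index. *)
have coef_le_lead m : forall i : 'I_n.+1, (n - i = m)%N ->
    octnorm (a i) * r ^+ m <= octnorm (a ord_max).
  elim: m => [|m IHm] i nim.
    suff -> : i = ord_max by rewrite mulr1.
    by apply/val_inj/eqP; rewrite eqn_leq -ltnS ltn_ord /= -subn_eq0 nim.
  have i1_lt : (i.+1 < n.+1)%N by rewrite ltnS -subn_gt0 nim.
  have n_i1 : (n - i.+1 = m)%N by rewrite subnS nim.
  apply: le_trans (IHm (Ordinal i1_lt) n_i1).
  by have := @coef_le i (Ordinal i1_lt) erefl; rewrite /= nim n_i1.
rewrite mulrC ler_pdivlMr // mulrC.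
apply: greatest_trinomial_root_ge K1_greatest _.
(* Both sides are scaled by [|a_n| > 0], so that each lower term can be compared with
   [(r |q|)^k |a_n|]. *)
rewrite -(ler_pM2r lead_gt0) mulr_suml.
(* At a zero, [q^n a_n] is minus the sum of the lower terms. *)
have lead_le : octnorm q ^+ n * octnorm (a ord_max) <=
    \sum_(k < n) octnorm q ^+ k * octnorm (a (widen_ord (leqnSn n) k)).
  move: q_zero; rewrite /octpoly big_ord_recr /= => /eqP.
  rewrite addrC addr_eq0 => /eqP lead_eq.
  rewrite -octnorm_exp -octnormM lead_eq octnormN.
  apply: le_trans (octnorm_sum _) _.
  by apply: ler_sum => k _; rewrite octnormM octnorm_exp.
rewrite exprMn -mulrA.
apply: le_trans (ler_wpM2l (ltW (exprn_gt0 n r_gt0)) lead_le) _.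
rewrite mulr_sumr; apply: ler_sum => k _.
set ak := a _; have k_le : (k <= n)%N by exact: ltnW.
have ak_le : octnorm ak * r ^+ (n - k) <= octnorm (a ord_max).
  exact: coef_le_lead.
(* Splitting [r^n] gives [r^k] to [|q|^k] and [r^(n-k)] to [|a_k|], where the coefficient bound
   applies. *)
have rn : r ^+ n = r ^+ k * r ^+ (n - k) by rewrite -exprD subnKC.
have -> : r ^+ n * (octnorm q ^+ k * octnorm ak) =
    (r * octnorm q) ^+ k * (octnorm ak * r ^+ (n - k)).
  by rewrite rn exprMn; ring.
by apply: ler_wpM2l => //; rewrite exprn_ge0 // mulr_ge0 ?octnorm_ge0 // ltW.
Qed.
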